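(* Let $T$ be any infinite, locally finite tree rooted at $o$ and having no leaves except possibly $o$. Let $\{J_v : v\in V(T), v\neq o\}$ be interaction strengths satisfying $0<J_{\min}\le J_v\le J_{\max}<\infty$ for all $v\ne o$, let $\beta>0$, and assign resistance $$R_v=\prod_{o<y\le v}(\tanh(\beta J_y))^{-1}$$ to the edge between $v$ and its parent. Then the decreasing limit $$\lim_{N\to\infty}\mathbf P^{(N,+)}(\eta(o)=+1)$$ is equal to $1/2$ if and only if $\mathrm{cap}_3(T)=0$.
   Context: For vertices, $y\le w$ means $y$ lies on the path from the root $o$ to $w$; $y<w$ means $y\le w$, $y\neq w$. $v\to w$ means $v$ is the parent of $w$ (the neighbor of $w$ closer to $o$). $|v|$ is the distance from $o$ to $v$. The interaction $J_w$ is attached to the edge from $w$ to its parent. Plus boundary conditions: $T^{(N)}$ is the subtree induced on $\{v:|v|\le N\}$. $\mathbf P^{(N,+)}$ is the probability measure on the set of configurations $\eta:V(T^{(N)})\to\{\pm1\}$ with $\eta(v)=+1$ for all $|v|=N$, with $\mathbf P^{(N,+)}(\eta)$ proportional to $W(\eta)=\prod_{v\to w}\exp(\beta J_w\eta(v)\eta(w))$ (product over edges of $T^{(N)}$). Capacity: $\partial T$ is the set of maximal (here infinite) paths from $o$ directed away from the root. A flow $\mu$ is a nonnegative function on edges with $\mu(vw)=\sum_{y:w\to y}\mu(wy)$ whenever $v\to w$ and $w$ is not a leaf; $|\mu|=\sum_{y:o\to y}\mu(oy)$. For $p>1$, $s=p-1$ and resistances $R(e)$, set $V_\mu(y)=\sum_{e\in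 y}(\mu(e)R(e))^s$ for $y\in\partial T$, $V(\mu)=\sup_{y\in\partial T}V_\mu(y)$, and $\mathrm{cap}_p(T)=\sup\{|\mu| : \mu \text{ a flow on } T \text{ with } V(\mu)=1\}$ (equal to $0$ if there is no such flow). *)

(* Defs.v *)
From HB Require Import structures.
From mathcomp Require Import all_boot all_order all_algebra finmap.
From mathcomp Require Import all_classical all_reals all_analysis.
Set Implicit Arguments.
Unset Strict Implicit.
Unset Printing Implicit Defensive.
Import Order.TTheory GRing.Theory Num.Theory.
Import numFieldNormedType.Exports.
Local Open Scope classical_set_scope.
Local Open Scope ring_scope.

Definition tanh {R : realType} (x : R) : R :=
  (expR x - expR (- x)) / (expR x + expR (- x)).

Section Tree.
Context {V : choiceType}.
Variable adj : rel V.

(* As in [path], the sequence p omits the starting point x. *)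
Definition simple_path (x y : V) (p : seq V) : Prop :=
  [/\ path adj x p, last x p = y & uniq (x :: p)].

Definition is_tree : Prop :=
  [/\ symmetric adj, irreflexive adj &
      forall x y, exists! p, simple_path x y p].

Definition locally_finite : Prop := forall v, finite_set [set w | adj v w].

Definition is_leaf (v : V) : Prop := exists w, [set u | adj v u] = [set w].

Variable o : V.

(* The vertices y with o < y <= w, in order; [::] if w = o. *)
Definition root_path (w : V) : seq V := xget [::] [set p | simple_path o w p].

Definition depth (v : V) : nat := size (root_path v).

Definition parent (v w : V) : bool := adj v w && (depth v < depth w)%N.

Definition children (v : V) : set V := [set w | parent v w].

(* The vertex set of T^(N). [fset_set] is a junk value on infinite sets, but
   these balls are finite when the tree is locally finite. *)
Definition ball_vertices (N : nat) : {fset V} :=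
  fset_set [set v | (depth v <= N)%N].

End Tree.

Section Ising.
Context {R : realType} {V : choiceType}.
Variables (adj : rel V) (o : V) (J : V -> R) (beta : R).

Definition spin (b : bool) : R := if b then 1 else -1.

Section Level.
Variable N : nat.
Local Notation B := (ball_vertices adj o N).

(* true stands for the spin +1 and false for the spin -1. *)
Definition config := {ffun B -> bool}.

Definition plus_boundary (eta : config) : bool :=
  [forall v : B, (depth adj o (val v) == N) ==> eta v].

Definition weight (eta : config) : R :=
  \prod_(v : B) \prod_(w : B | parent adj o (val v) (val w))
    expR (beta * J (val w) * spin (eta v) * spin (eta w)).

Definition partition_function : R :=
  \sum_(eta : config | plus_boundary eta) weight eta.

Definition prob_plus (A : pred config) : R :=
  \sum_(eta : config | plus_boundary eta && A eta)
    weight eta / partition_function.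

(* The event eta(o) = +1; u ranges over the vertices of T^(N). *)
Definition root_plus (eta : config) : bool :=
  [exists u : B, (val u == o) && eta u].

End Level.
End Ising.
Arguments prob_plus {R V} adj o J beta N A.
Arguments root_plus {V} adj o N eta.

Section Capacity.
Context {R : realType} {V : choiceType}.
Variables (adj : rel V) (o : V).

Definition boundary : set (nat -> V) :=
  [set y | y 0%N = o /\ forall n, parent adj o (y n) (y n.+1)].

(* Functions on edges are indexed by the endpoint farther from the root; their
   value at o is irrelevant. *)
Definition is_flow (mu : V -> R) : Prop :=
  (forall w, w != o -> 0 <= mu w) /\
  (forall v w, parent adj o v w -> ~ is_leaf adj w ->
     mu w = \sum_(y \in children adj o w) mu y).

Definition flow_strength (mu : V -> R) : R :=
  \sum_(y \in children adj o o) mu y.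

Definition path_potential (p : R) (res mu : V -> R) (y : nat -> V) : \bar R :=
  (\sum_(0 <= n <oo) ((mu (y n.+1) * res (y n.+1)) `^ (p - 1))%:E)%E.

Definition potential (p : R) (res mu : V -> R) : \bar R :=
  ereal_sup [set path_potential p res mu y | y in boundary].

Definition capacity (p : R) (res : V -> R) : \bar R :=
  let strengths := [set (flow_strength mu)%:E | mu in
    [set mu | is_flow mu /\ potential p res mu = 1%E]] in
  if strengths == set0 then 0%E else ereal_sup strengths.

End Capacity.

Definition ising_resistance {R : realType} {V : choiceType} (adj : rel V)
    (o : V) (J : V -> R) (beta : R) (v : V) : R :=
  \prod_(y <- root_path adj o v) (tanh (beta * J y))^-1.

(* Main.v *)
(* Let t_w = tanh (beta J_w). Integrating out the spins level by level shows
   that P^(N,+)(eta(o) = +1) = (1 + M_N(o)) / 2, where M_0 = 1 and M_{k+1}(v) is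
   the relativistic (tanh-addition) sum of the t_w M_k(w) over the children w of
   v. As M_k(v) decreases to some m(v), the limit is 1/2 iff m(o) = 0.

   If mu is a flow with V(mu) = 1, put a_v = mu(v) R_v. By induction on k,
   a_v^2 <= (1 - \sum_{o < u <= v} a_u^2 + a_v^2) M_k(v)^2, using that
   sinh (\sum h_i) >= \sum tanh h_i. At v = o this bounds m(o) below in terms
   of |mu|.

   If m(o) > 0, work with tau(v) = tanh (h / 2) where m(v) = tanh h. Writing
   sigma(w) for the same function of t_w m(w), subadditivity gives
   tau(v) <= \sum_w sigma(w), while sigma^2 (1 + c tau(w)^2) <= t_w^2 tau(w)^2
   for a constant c > 0. Start with tau(o) units of flow at the root and split
   at each vertex in proportion to sigma. With b_v = a_v / tau(v) one gets
   b_w^2 + c a_w^2 <= b_v^2 for v -> w, which telescopes to V(mu) <= 1 / c. *)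
Require Import Defs.
From mathcomp Require Import all_boot all_order all_algebra.
From mathcomp Require Import all_classical all_reals all_analysis.
From mathcomp Require Import finmap zify ring lra.
Set Implicit Arguments.
Unset Strict Implicit.
Unset Printing Implicit Defensive.
Import Order.TTheory GRing.Theory Num.Theory.
Import numFieldNormedType.Exports.
Local Open Scope classical_set_scope.
Local Open Scope ring_scope.

(** * Tanh-addition of numbers in [0, 1] *)

Section RelativisticSum.
Context {R : realType} {I : eqType}.
Implicit Types (s : seq I) (x y p : I -> R).

(** With [x w = tanh h_w] this is the tanh of the sum of the [h_w], since [(1 + x w) / (1 - x w)] is
    [exp (2 h_w)]. In this form a term equal to 1 needs no infinite rapidity. *)
Definition rsum s x : R :=
  (\prod_(w <- s) (1 + x w) - \prod_(w <- s) (1 - x w)) /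
  (\prod_(w <- s) (1 + x w) + \prod_(w <- s) (1 - x w)).

(** The source of every bound on [rsum = (P - Q) / (P + Q)]; the induction needs the estimates
    jointly. The upper bound on [P - Q] is subadditivity of tanh; the lower one, with [P * Q <= 1],
    is sinh of a sum of rapidities dominating the sum of their tanh. *)
Lemma prod_oneDB_bounds s x : (forall w, w \in s -> 0 <= x w <= 1) ->
  let P := \prod_(w <- s) (1 + x w) in let Q := \prod_(w <- s) (1 - x w) in
  let X := \sum_(w <- s) x w in
  [/\ 0 <= X, 0 <= Q, 2 <= P + Q, P * Q <= 1 &
      2 * X <= P - Q <= (P + Q) * X].
Proof.
elim: s => [|a s IH] hx /=; first by rewrite !big_nil; split; lra.
have [|X0 Q0 PQ1 PQ2 /andP[h1 h2]] := IH; first by move=> w ws; apply: hx; rewrite inE ws orbT.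
have /andP[a0 a1] : 0 <= x a <= 1 by apply: hx; rewrite inE eqxx.
rewrite !big_cons.
move: X0 Q0 PQ1 PQ2 h1 h2.
set X := \sum_(w <- s) x w; set P := \prod_(w <- s) (1 + x w).
set Q := \prod_(w <- s) (1 - x w) => X0 Q0 PQ1 PQ2 h1 h2.
(* Adjoining [a] adds [x a * (P - Q)] to [P + Q] and [x a * (P + Q)] to [P - Q]; these facts control
   the cross terms. *)
have xD : 0 <= x a * (P - Q) by apply: mulr_ge0 => //; lra.
have xS : 0 <= x a * (P + Q - 2) by apply: mulr_ge0 => //; lra.
have XD : 0 <= X * (x a * (P - Q)) by apply: mulr_ge0.
have xxD : 0 <= x a * (x a * (P - Q)) by apply: mulr_ge0.
split.
- lra.
- by apply: mulr_ge0 => //; lra.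
- lra.
- rewrite mulrACA; have -> : (1 + x a) * (1 - x a) = 1 - x a ^+ 2 by ring.
  have PQ0 : 0 <= P * Q by apply: mulr_ge0 => //; lra.
  have : 0 <= x a ^+ 2 * (P * Q) by apply: mulr_ge0 => //; exact: sqr_ge0.
  lra.
- by apply/andP; split; lra.
Qed.

Lemma rsum_itv s x : (forall w, w \in s -> 0 <= x w <= 1) -> 0 <= rsum s x <= 1.
Proof.
move=> /prod_oneDB_bounds /= [X0 Q0 S2 _ /andP[h1 h2]].
rewrite /rsum divr_ge0 ?ler_pdivrMr; lra.
Qed.

Lemma rsum_le_sum s x : (forall w, w \in s -> 0 <= x w <= 1) ->
  rsum s x <= \sum_(w <- s) x w.
Proof.
move=> /prod_oneDB_bounds /= [X0 Q0 S2 _ /andP[h1 h2]].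
by rewrite /rsum ler_pdivrMr; lra.
Qed.

(* With [rsum = D / S], one has [S ^+ 2 - D ^+ 2 <= 1] and [D >= \sum x]. *)
Lemma sqr_sum_le_rsum s x : (forall w, w \in s -> 0 <= x w <= 1) ->
  (\sum_(w <- s) x w) ^+ 2 <=
  (1 + (\sum_(w <- s) x w) ^+ 2) * rsum s x ^+ 2.
Proof.
move=> /prod_oneDB_bounds /= [].
rewrite /rsum; move: (\prod_(w <- s) (1 + x w)) (\prod_(w <- s) (1 - x w)) => P Q.
move: (\sum_(w <- s) x w) => X X0 Q0 S2 PQ /andP[h1 _].
rewrite expr_div_n mulrA ler_pdivlMr; last by apply: exprn_gt0; lra.
have : (2 * X) ^+ 2 <= (P - Q) ^+ 2 by rewrite ler_sqr ?nnegrE; lra.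
have : 0 <= X ^+ 2 * (1 - P * Q) by apply: mulr_ge0; [exact: sqr_ge0|lra].
rewrite !expr2 => ? ?; lra.
Qed.

Lemma ler_rsum s x y : (forall w, w \in s -> 0 <= x w <= 1) ->
  (forall w, w \in s -> x w <= y w <= 1) -> rsum s x <= rsum s y.
Proof.
move=> hx hy.
have hy' w : w \in s -> 0 <= y w <= 1.
  by move=> ws; have := hx _ ws; have := hy _ ws; lra.
have [_ Qx Sx _ _] := prod_oneDB_bounds hx.
have [_ Qy Sy _ _] := prod_oneDB_bounds hy'.
have PP : \prod_(w <- s) (1 + x w) <= \prod_(w <- s) (1 + y w).
  rewrite big_seq [leRHS]big_seq; apply: ler_prod => w ws.
  by have := hx _ ws; have := hy _ ws; lra.
have QQ : \prod_(w <- s) (1 - y w) <= \prod_(w <- s) (1 - x w).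
  rewrite big_seq [leRHS]big_seq; apply: ler_prod => w ws.
  by have := hx _ ws; have := hy _ ws; lra.
have Px : 0 <= \prod_(w <- s) (1 + x w).
  by rewrite big_seq; apply: prodr_ge0 => w ws; have := hx _ ws; lra.
move: Qx Sx Qy Sy PP QQ Px; rewrite /rsum.
move: (\prod_(w <- s) (1 + x w)) (\prod_(w <- s) (1 - x w)) => P Q.
move: (\prod_(w <- s) (1 + y w)) (\prod_(w <- s) (1 - y w)) => P' Q'.
(* Once denominators are cleared, the claim is exactly [P * Q' <= P' * Q]. *)
move=> Q0 S0 Q'0 S'0 PP QQ P0; have h := ler_pM P0 Q'0 PP QQ.
rewrite ler_pdivrMr; last lra.
rewrite mulrAC ler_pdivlMr; last lra.
lra.
Qed.

(* In the rapidity [h], where [x = tanh h] and [p = tanh (h / 2)], [rsum] is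
   addition; it therefore commutes with halving. *)
Lemma rsum_double s x p : (forall w, w \in s -> 0 <= p w <= 1) ->
  (forall w, w \in s -> x w * (1 + p w ^+ 2) = 2 * p w) ->
  rsum s x * (1 + rsum s p ^+ 2) = 2 * rsum s p.
Proof.
move=> hp xp.
have [_ _ S2 _ _] := prod_oneDB_bounds hp.
(* The relation between [x] and [p] says [(1 + p ^+ 2) * (1 + x) = (1 + p) ^+ 2], and likewise with
   minus signs. *)
have HP : \prod_(w <- s) (1 + p w ^+ 2) * \prod_(w <- s) (1 + x w) =
          (\prod_(w <- s) (1 + p w)) ^+ 2.
  rewrite -big_split -prodrXl /= big_seq [RHS]big_seq; apply: eq_bigr => w ws.
  by rewrite mulrDr mulr1 mulrC xp //; ring.
have HQ : \prod_(w <- s) (1 + p w ^+ 2) * \prod_(w <- s) (1 - x w) =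
          (\prod_(w <- s) (1 - p w)) ^+ 2.
  rewrite -big_split -prodrXl /= big_seq [RHS]big_seq; apply: eq_bigr => w ws.
  by rewrite mulrBr mulr1 mulrC xp //; ring.
have E0 : 0 < \prod_(w <- s) (1 + p w ^+ 2).
  by apply: prodr_gt0 => w _; have := sqr_ge0 (p w); lra.
move: S2 HP HQ E0; rewrite /rsum.
move: (\prod_(w <- s) (1 + p w)) (\prod_(w <- s) (1 - p w)) => A B.
move: (\prod_(w <- s) (1 + x w)) (\prod_(w <- s) (1 - x w)) => P Q.
move: (\prod_(w <- s) _) => E S2 HP HQ E0.
have AB : 0 < A ^+ 2 + B ^+ 2.
  have : 2 ^+ 2 <= (A + B) ^+ 2 by rewrite ler_sqr ?nnegrE; lra.
  have := sqr_ge0 (A - B); rewrite !expr2; lra.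
have -> : (P - Q) / (P + Q) = (A ^+ 2 - B ^+ 2) / (A ^+ 2 + B ^+ 2).
  rewrite -HP -HQ -mulrBr -mulrDr -mulf_div divff ?mul1r //; lra.
field; apply/andP; split; lra.
Qed.

End RelativisticSum.

(** * Halving the rapidity *)

Section Half.
Context {R : realType}.
Implicit Types m p r t c : R.

(* tanh h |-> tanh (h / 2) *)
Definition half m : R := m / (1 + Num.sqrt (1 - m ^+ 2)).

Lemma half_double m : 0 <= m <= 1 -> m * (1 + half m ^+ 2) = 2 * half m.
Proof.
move=> hm.
have h : 0 <= 1 - m ^+ 2.
  by have : m ^+ 2 <= 1 ^+ 2 by [rewrite ler_sqr ?nnegrE; lra]; lra.
have := sqr_sqrtr h; have := sqrtr_ge0 (1 - m ^+ 2); rewrite /half.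
move: (Num.sqrt _) => q q0 hq.
have -> : m * (1 + (m / (1 + q)) ^+ 2) =
   m * ((1 + q) ^+ 2 + m ^+ 2) / (1 + q) ^+ 2 by field; lra.
have -> : m ^+ 2 = 1 - q ^+ 2 by lra.
by field; lra.
Qed.

Lemma half_itv m : 0 <= m <= 1 -> 0 <= half m <= 1.
Proof.
move=> hm; have := sqrtr_ge0 (1 - m ^+ 2) => q0.
rewrite /half divr_ge0 ?ler_pdivrMr; lra.
Qed.

Lemma half_gt0 m : 0 < m -> 0 < half m.
Proof.
by move=> m0; rewrite divr_gt0 //; have := sqrtr_ge0 (1 - m ^+ 2); lra.
Qed.

(** The two sides differ by [(p - r) * (1 - p * r)]: the map [p / (1 + p ^+ 2)] increases on
    [0, 1]. *)
Lemma le_half p r : 0 <= p <= 1 -> 0 <= r <= 1 ->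
  p * (1 + r ^+ 2) <= r * (1 + p ^+ 2) -> p <= r.
Proof.
move=> hp hr h; rewrite leNgt; apply/negP => rp.
have : 0 < (p - r) * (1 - p * r).
  apply: mulr_gt0; first lra.
  by have : p * r < 1; [have : p * r <= 1 * r by [apply: ler_wpM2r; lra]; lra|lra].
rewrite !expr2 in h *; lra.
Qed.

(** For [m != 0] the equation is quadratic in [r] with reciprocal roots, so [0, 1] contains only one
    value. *)
Lemma half_unique m r : 0 <= m <= 1 -> 0 <= r <= 1 ->
  m * (1 + r ^+ 2) = 2 * r -> half m = r.
Proof.
move=> hm hr mr; have hp := half_itv hm; have mp := half_double hm.
have E : half m * (1 + r ^+ 2) = r * (1 + half m ^+ 2).
  have : m * ((1 + half m ^+ 2) * r) = m * (half m * (1 + r ^+ 2)).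
    by rewrite mulrA mp (mulrCA m) mr; ring.
  have [m0|m0] := eqVneq m 0.
    have r0 : r = 0 by rewrite m0 mul0r in mr; lra.
    by rewrite m0 r0 /half !mul0r.
  by move/(mulfI m0); lra.
by apply: le_anti; apply/andP; split; apply: le_half; rewrite ?E.
Qed.

(** Halving commutes with [rsum], and [rsum] is at most the ordinary sum. *)
Lemma half_rsum_le (I : eqType) (s : seq I) (x : I -> R) :
  (forall w, w \in s -> 0 <= x w <= 1) ->
  half (rsum s x) <= \sum_(w <- s) half (x w).
Proof.
move=> hx.
have hp w : w \in s -> 0 <= half (x w) <= 1 by move=> /hx /half_itv.
rewrite (@half_unique _ (rsum s (fun w => half (x w)))).
- exact: rsum_le_sum.
- exact: rsum_itv.
- exact: rsum_itv.
- by apply: rsum_double => // w /hx /half_double.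
Qed.

(** Sharpens [half (t * m) <= t * half m] by a factor quadratic in [half m]. This gain, available
    because [t < 1], pays for the energy of the flow built from the magnetization. *)
Lemma sqr_half_scale_le m t c : 0 <= m <= 1 -> 0 < t < 1 ->
  0 <= c -> 2 * c <= 1 - t ^+ 2 ->
  half (t * m) ^+ 2 * (1 + c * half m ^+ 2) <= t ^+ 2 * half m ^+ 2.
Proof.
move=> hm ht c0 hc.
have htm : 0 <= t * m <= 1.
  have : 0 <= t * m by apply: mulr_ge0; lra.
  by have : t * m <= t * 1 by [apply: ler_wpM2l; lra]; lra.
have hp := half_itv hm; have hq := half_itv htm.
(* Eliminates the square roots: with [p = half m] and [q = half (t * m)] only
   [q * (1 + p ^+ 2) = t * p * (1 + q ^+ 2)] is used. *)
have E : half (t * m) * (1 + half m ^+ 2) = t * half m * (1 + half (t * m) ^+ 2).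
  have e1 := half_double hm; have e2 := half_double htm.
  have : 2 * half (t * m) * (1 + half m ^+ 2) =
         t * (2 * half m) * (1 + half (t * m) ^+ 2) by rewrite -e1 -e2; ring.
  lra.
move: hp hq E; move: (half m) (half (t * m)) => p q hp hq E.
have p20 := sqr_ge0 p; have q20 := sqr_ge0 q; have t20 := sqr_ge0 t.
have p21 : p ^+ 2 <= 1 by have : p ^+ 2 <= 1 ^+ 2 by [rewrite ler_sqr ?nnegrE; lra]; lra.
have qp : q <= p.
  apply: le_half => //; rewrite E; apply: ler_wpM2r; first lra.
  by rewrite ler_piMl; lra.
have q2p2 : q ^+ 2 <= p ^+ 2 by rewrite ler_sqr ?nnegrE; lra.
have tp0 : 0 <= t * p by apply: mulr_ge0; lra.
have qtp : q <= t * p.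
  rewrite -(@ler_pM2r _ (1 + p ^+ 2)); last lra.
  by rewrite E; apply: ler_wpM2l => //; lra.
have q2tp2 : q ^+ 2 <= t ^+ 2 * p ^+ 2 by rewrite -exprMn ler_sqr ?nnegrE; lra.
(* By [E] the goal is [(1 + q ^+ 2) ^+ 2 * (1 + c * p ^+ 2) <= (1 + p ^+ 2) ^+ 2]; one factor is
   [K], the other follows from [q <= p]. *)
have K : (1 + q ^+ 2) * (1 + c * p ^+ 2) <= 1 + p ^+ 2.
  have cp0 : 0 <= c * p ^+ 2 by apply: mulr_ge0.
  apply: (@le_trans _ _ ((1 + t ^+ 2 * p ^+ 2) * (1 + c * p ^+ 2))).
    by apply: ler_wpM2r; lra.
  (* In turn: bound [p ^+ 4] by [p ^+ 2], bound [c] by [(1 - t ^+ 2) / 2], and the leftover is a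
     multiple of [(1 - t ^+ 2) ^+ 2]. *)
  have : 0 <= c * t ^+ 2 * p ^+ 2 * (1 - p ^+ 2).
    by apply: mulr_ge0; [apply: mulr_ge0 => //; apply: mulr_ge0|lra].
  have : 0 <= (1 - t ^+ 2 - 2 * c) * (p ^+ 2 * (1 + t ^+ 2)).
    by apply: mulr_ge0; [lra|apply: mulr_ge0; lra].
  have : 0 <= p ^+ 2 * ((1 - t ^+ 2) * (1 - t ^+ 2)).
    by apply: mulr_ge0 => //; rewrite -expr2; exact: sqr_ge0.
  lra.
have S0 : 0 < (1 + p ^+ 2) ^+ 2 by apply: exprn_gt0; lra.
rewrite -(ler_pM2r S0).
have -> : q ^+ 2 * (1 + c * p ^+ 2) * (1 + p ^+ 2) ^+ 2 =
    (q * (1 + p ^+ 2)) ^+ 2 * (1 + c * p ^+ 2) by ring.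
rewrite E.
have -> : (t * p * (1 + q ^+ 2)) ^+ 2 * (1 + c * p ^+ 2) =
    t ^+ 2 * p ^+ 2 * ((1 + q ^+ 2) * ((1 + q ^+ 2) * (1 + c * p ^+ 2))) by ring.
apply: ler_wpM2l; first exact: mulr_ge0.
rewrite [leRHS]expr2; apply: ler_pM => //; try lra.
by apply: mulr_ge0; [lra|have : 0 <= c * p ^+ 2 by [apply: mulr_ge0]; lra].
Qed.

End Half.

(** * Root paths, parents and finite balls in a rooted tree *)

Section RootedTree.
Context {V : choiceType} {adj : rel V} (o : V).
Hypothesis tree : is_tree adj.
Local Notation root_path := (root_path adj o).
Local Notation depth := (depth adj o).
Local Notation parent := (parent adj o).

Lemma root_pathP w : simple_path adj o w (root_path w).
Proof.
have [_ _ /(_ o w) [p [hp _]]] := tree.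
by apply: (@xgetPex _ [::] [set p | simple_path adj o w p]); exists p.
Qed.

Lemma root_path_unique w p : simple_path adj o w p -> p = root_path w.
Proof.
have [_ _ /(_ o w) [q [_ uq]]] := tree => hp.
by rewrite -(uq _ hp); apply: uq; exact: root_pathP.
Qed.

Lemma root_path_o : root_path o = [::].
Proof. by apply/esym/root_path_unique; split. Qed.

Lemma depth_o : depth o = 0%N.
Proof. by rewrite /Defs.depth root_path_o. Qed.

Lemma depth_eq0 v : (depth v == 0%N) = (v == o).
Proof.
apply/idP/eqP => [|->]; last by rewrite depth_o.
rewrite /Defs.depth size_eq0 => /eqP e.
by have [_ <- _] := root_pathP v; rewrite e.
Qed.

Lemma root_path_prefix w p q : root_path w = p ++ q ->
  root_path (last o p) = p.
Proof.
have [+ _ +] := root_pathP w => + + e; rewrite e cat_path -cat_cons cat_uniq.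
by move=> /andP[pp _] /andP[up _]; apply/esym/root_path_unique.
Qed.

(** If [w] is off the path to [v], appending it gives a simple path; otherwise [w] cuts that path at
    its own root path. *)
Lemma root_path_snoc_or v w : adj v w ->
  root_path w = rcons (root_path v) w \/
  exists q, root_path v = root_path w ++ q.
Proof.
move=> vw; have [pv lv uv] := root_pathP v.
have [wv|wv] := boolP (w \in o :: root_path v); last first.
  left; apply/esym/root_path_unique; split.
  - by rewrite rcons_path pv lv.
  - by rewrite last_rcons.
  - by rewrite -rcons_cons rcons_uniq wv.
right; have /splitPl := wv; case E : _ / => [p q lp].
by exists q; rewrite -lp (root_path_prefix E).
Qed.

Lemma parent_root_path v w :
  parent v w -> root_path w = rcons (root_path v) w.
Proof.
move=> /andP[/root_path_snoc_or [//|[q e]]].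
by rewrite /Defs.depth e size_cat ltnNge leq_addr.
Qed.

Lemma depth_parent v w : parent v w -> depth w = (depth v).+1.
Proof. by rewrite /Defs.depth => /parent_root_path ->; rewrite size_rcons. Qed.

Lemma parent_neq_root v w : parent v w -> w != o.
Proof. by move=> vw; rewrite -depth_eq0 (depth_parent vw). Qed.

(** The penultimate vertex of [o :: root_path w]; the default [o] of [last] is the correct answer
    for children of the root, and is also the value at [o]. *)
Definition parent_of (w : V) : V := last o (behead (belast o (root_path w))).

Lemma parent_ofP v w : parent v w -> parent_of w = v.
Proof.
move=> /parent_root_path e; rewrite /parent_of e belast_rcons /=.
by have [_ ->] := root_pathP v.
Qed.

Lemma parent_parent_of w : w != o -> parent (parent_of w) w.
Proof.
rewrite /parent_of => wo; have [pw lw _] := root_pathP w.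
case/lastP E : (root_path w) pw lw => [|p x] /=.
  by move=> _ ow; rewrite ow eqxx in wo.
rewrite rcons_path last_rcons belast_rcons /= => /andP[_ a] xw.
rewrite /Defs.parent -xw a /= /Defs.depth xw E size_rcons.
by rewrite (@root_path_prefix w p [:: x]) ?cats1.
Qed.

Lemma parent_eq v w : w != o -> parent v w = (v == parent_of w).
Proof.
by move=> wo; apply/idP/eqP => [/parent_ofP //|->]; exact: parent_parent_of.
Qed.

(** If neither path extends the other by one vertex, each is a prefix of the other, so [v = w],
    against irreflexivity. *)
Lemma adj_parent_or v w : adj v w -> parent v w \/ parent w v.
Proof.
move=> vw; have [e|[q e]] := root_path_snoc_or vw.
  by left; rewrite /Defs.parent vw /Defs.depth e size_rcons /=.
have [sym irr _] := tree.
have [|e'|[q' e']] := @root_path_snoc_or w v; first by rewrite sym.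
  by right; rewrite /Defs.parent sym vw /Defs.depth e' size_rcons /=.
have vw' : root_path v = root_path w.
  move: e; rewrite e' -catA => /(congr1 size); rewrite !size_cat => h.
  have : size q' = 0%N by move: h; lia.
  by move/size0nil => ->; rewrite cats0.
have [_ lv _] := root_pathP v; have [_ lw _] := root_pathP w.
by move: vw; rewrite -lv vw' lw irr.
Qed.

(** A childless [w] would have its parent as only neighbor. *)
Lemma exists_child w : w != o -> ~ is_leaf adj w -> exists u, parent w u.
Proof.
move=> wo; apply: contra_notP => nc; exists (parent_of w).
have pw := parent_parent_of wo; have [sym _ _] := tree.
apply/seteqP; split => u /=.
  by case/adj_parent_or => [wu|/parent_ofP <- //]; case: nc; exists u.
by move=> ->; rewrite sym; case/andP: pw.
Qed.

Hypothesis loc_fin : locally_finite adj.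

Lemma finite_children v : finite_set (children adj o v).
Proof.
by apply: sub_finite_set (loc_fin v) => w /= /andP[].
Qed.

Lemma finite_ball N : finite_set [set v | (depth v <= N)%N].
Proof.
elim: N => [|N IH].
  apply: sub_finite_set (finite_set1 o) => v /=.
  by rewrite leqn0 depth_eq0 => /eqP.
apply: (@sub_finite_set _ _ ([set o] `|` \bigcup_(v in [set v | (depth v <= N)%N])
  children adj o v)).
  move=> v /= hv; have [->|vo] := eqVneq v o; first by left.
  right; have pv := parent_parent_of vo; exists (parent_of v) => //=.
  by rewrite -ltnS -(depth_parent pv).
rewrite finite_setU; split; first exact: finite_set1.
by apply: bigcup_finite => // v _; exact: finite_children.
Qed.

Lemma in_ball N v : (v \in ball_vertices adj o N) = (depth v <= N)%N.
Proof.
by rewrite /ball_vertices in_fset_set; [apply/idP/idP => [/set_mem|/mem_set]|exact: finite_ball].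
Qed.

Lemma in_children v w : (w \in fset_set (children adj o v)) = parent v w.
Proof.
by rewrite in_fset_set; [apply/idP/idP => [/set_mem|/mem_set]|exact: finite_children].
Qed.

End RootedTree.

(** * The magnetization recursion *)

Section Magnetization.
Context {R : realType} {V : choiceType} (adj : rel V) (o : V) (t : V -> R).

(** Here [k] is the distance from [v] down to the plus boundary; for [k = 0] the vertex is itself
    fixed at +1. *)
Fixpoint magnetization (k : nat) (v : V) : R :=
  if k is k'.+1 then
    rsum (fset_set (children adj o v)) (fun w => t w * magnetization k' w)
  else 1.

Hypothesis tree : is_tree adj.
Hypothesis loc_fin : locally_finite adj.
Hypothesis t_itv : forall v, v != o -> 0 < t v < 1.

Lemma scale_itv m v w : w \in fset_set (children adj o v) -> 0 <= m <= 1 ->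
  0 <= t w * m <= 1.
Proof.
rewrite in_children // => /(parent_neq_root tree) /t_itv tw hm.
have : 0 <= t w * m by apply: mulr_ge0; lra.
by have : t w * m <= t w * 1 by [apply: ler_wpM2l; lra]; lra.
Qed.

Lemma magnetization_itv k v : 0 <= magnetization k v <= 1.
Proof.
elim: k v => [|k IH] v /=; first by rewrite ler01 lexx.
by apply: rsum_itv => w vw; apply: scale_itv vw (IH w).
Qed.

(** The boundary value 1 is maximal, and monotonicity of [rsum] carries the first comparison up the
    tree. *)
Lemma magnetization_nonincreasing k v :
  magnetization k.+1 v <= magnetization k v.
Proof.
elim: k v => [|k IH] v; first by have /andP[] := magnetization_itv 1 v.
apply: ler_rsum => w vw; first exact: scale_itv vw (magnetization_itv k.+1 w).
have /andP[_ ->] := scale_itv vw (magnetization_itv k w); rewrite andbT.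
apply: ler_wpM2l; last exact: IH.
by move: vw; rewrite in_children // => /(parent_neq_root tree) /t_itv; lra.
Qed.

End Magnetization.

(** * Integrating out the Ising spins level by level *)

Section IsingRecursion.
Context {R : realType} {V : choiceType} (adj : rel V) (o : V).
Context (J : V -> R) (beta : R).
Hypothesis tree : is_tree adj.
Hypothesis loc_fin : locally_finite adj.
Local Notation ball := (ball_vertices adj o).
Local Notation depth := (depth adj o).
Local Notation parent := (parent adj o).
Local Notation parent_of := (parent_of (adj := adj) o).
Local Notation config := (config adj o).

Definition interaction (w : V) (b s : bool) : R :=
  expR (beta * J w * spin b * spin s).

(** A total function on [V] lets configurations on balls of different radii be compared; [false] is
    a default outside the ball. *)
Definition extend N (eta : config N) (v : V) : bool :=
  if insub v is Some u then eta u else false.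

Lemma extend_val N (eta : config N) u : extend eta (val u) = eta u.
Proof. by rewrite /extend valK. Qed.

Lemma extend_in N (eta : config N) v (vB : v \in ball N) :
  extend eta v = eta [` vB]%fset.
Proof. exact: (extend_val eta [` vB]%fset). Qed.

(** Each edge is indexed by its lower endpoint, whose unique parent also lies in the ball. *)
Lemma weightE N (eta : config N) : weight J beta eta =
  \prod_(w <- ball N | w != o)
    interaction w (extend eta (parent_of w)) (extend eta w).
Proof.
rewrite /weight (exchange_big_dep predT) //= big_seq_fsetE [RHS]big_mkcond /=.
apply: eq_bigr => w _; have [wo|wo] := eqVneq (val w) o.
  by rewrite big_pred0 // => v; apply/negP => /(parent_neq_root tree) /eqP.
have pB : parent_of (val w) \in ball N.
  rewrite in_ball // -ltnS -(depth_parent tree (parent_parent_of tree wo)).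
  by have := valP w; rewrite in_ball // => /leq_trans; apply.
rewrite (big_pred1 [` pB]%fset) => [|v]; last by rewrite parent_eq // -val_eqE.
by rewrite /interaction extend_val -(extend_val eta [` pB]%fset).
Qed.

(* The external factor at the vertices of depth [N] is [alpha]. *)
Definition boundary_sum N (kappa : bool -> R) (alpha : V -> bool -> R) : R :=
  \sum_(eta : config N) kappa (extend eta o) *
    (weight J beta eta *
     \prod_(w <- ball N | depth w == N) alpha w (extend eta w)).

Definition integrate_children (alpha : V -> bool -> R) (v : V) (b : bool) : R :=
  \prod_(w <- fset_set (children adj o v)) \sum_s interaction w b s * alpha w s.

(** Each vertex at depth [N.+1] is the child of exactly one vertex at depth [N]. *)
Lemma prod_ball_children N (F : V -> V -> R) :
  \prod_(v <- ball N | depth v == N)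
    \prod_(w <- fset_set (children adj o v)) F v w =
  \prod_(w <- ball N.+1 | depth w == N.+1) F (parent_of w) w.
Proof.
rewrite (eq_bigr (fun v => \prod_(w <- ball N.+1 | parent v w) F v w)); last first.
  move=> v /eqP vN; rewrite -[RHS]big_filter; apply: perm_big.
  apply: uniq_perm; rewrite ?filter_uniq ?fset_uniq // => w.
  rewrite mem_filter in_children // in_ball // andb_idr // => vw.
  by rewrite (depth_parent tree vw) vN.
rewrite (exchange_big_dep (fun w => depth w == N.+1)) /=; last first.
  by move=> v w /eqP vN /(depth_parent tree) ->; rewrite vN.
rewrite big_seq_cond [RHS]big_seq_cond; apply: eq_bigr => w /andP[_ wN].
have wo : w != o by rewrite -(depth_eq0 o tree) (eqP wN).
have dp : depth (parent_of w) = N.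
  by move: wN; rewrite (depth_parent tree (parent_parent_of tree wo)) eqSS => /eqP.
rewrite (eq_bigl (pred1 (parent_of w))) => [|v]; last first.
  by rewrite parent_eq //=; have [->|_] := eqVneq v; rewrite ?andbF // dp eqxx.
by rewrite -big_filter filter_pred1_uniq ?fset_uniq ?in_ball ?dp // big_seq1.
Qed.

(** Group configurations by their restriction to the smaller ball. Within a group the outermost
    spins vary independently, so the sum of products factors. *)
Lemma boundary_sum_rec N kappa alpha :
  boundary_sum N.+1 kappa alpha =
  boundary_sum N kappa (integrate_children alpha).
Proof.
pose restr (eta : config N.+1) : config N := [ffun v => extend eta (val v)].
rewrite /boundary_sum (partition_big restr xpredT) //=; apply: eq_bigr => eta _.
(* All factors attached to [w] when it has spin [b]; the parent's spin is read from the fixed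
   restriction [eta]. *)
pose H (w : V) (b : bool) : R :=
  (if w != o then interaction w (extend eta (parent_of w)) b else 1) *
  (if depth w == N.+1 then alpha w b else 1).
(* Inner spins are prescribed and outermost ones free, so the fibre over [eta] is a product set and
   distributivity applies. *)
pose Q (w : ball N.+1) (b : bool) := (depth (val w) <= N)%N ==> (b == extend eta (val w)).
have extE eta' v : restr eta' = eta -> (depth v <= N)%N ->
    extend eta' v = extend eta v.
  move=> <- vN; have vB : v \in ball N by rewrite in_ball.
  by rewrite (extend_in _ vB) ffunE.
have QE eta' : (restr eta' == eta) = (eta' \in family Q).
  apply/eqP/familyP => [e w|h].
    by apply/implyP => wN; rewrite -(extE _ _ e wN) extend_val.
  apply/ffunP => v; rewrite ffunE.
  have vN : (depth (val v) <= N)%N by have := valP v; rewrite in_ball.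
  have vB : val v \in ball N.+1 by rewrite in_ball // ltnW.
  have /implyP /(_ vN) /eqP := h [` vB]%fset.
  by rewrite -extend_val /= extend_val.
transitivity (\sum_(eta' in family Q)
    kappa (extend eta o) * \prod_(w : ball N.+1) H (val w) (eta' w)).
  apply: eq_big => [eta'|eta' /eqP e]; first by rewrite QE.
  rewrite extE // ?depth_o //; congr (_ * _).
  rewrite weightE big_mkcond [X in _ * X]big_mkcond -big_split /= big_seq_fsetE /=.
  apply: eq_bigr => w _; rewrite /H extend_val.
  have [wo|wo] := eqVneq (val w) o; rewrite /=.
    reflexivity.
  rewrite (extE _ (parent_of (val w)) e); first reflexivity.
  rewrite -ltnS.
  rewrite -(depth_parent tree (parent_parent_of tree wo)).
  by have := valP w; rewrite in_ball.
rewrite -big_distrr /=; congr (_ * _).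
rewrite -(bigA_distr_big_dep Q (fun w => H (val w))) /=.
rewrite -(big_seq_fsetE _ (ball N.+1) xpredT (fun w =>
  \sum_(b | (depth w <= N)%N ==> (b == extend eta w)) H w b)) /=.
(* Inner vertices have one admissible spin and give the weight of [eta]; the outermost ones give the
   new boundary factor. *)
rewrite (bigID (fun w => (depth w <= N)%N)) /= weightE; congr (_ * _).
  rewrite [RHS]big_mkcond -big_filter -[RHS]big_filter filter_predT.
  rewrite (@perm_big _ _ _ _ _ (ball N)); last first.
    apply: uniq_perm; rewrite ?filter_uniq ?fset_uniq // => w.
    by rewrite mem_filter !in_ball // andb_idr // => /leqW.
  rewrite big_seq [RHS]big_seq; apply: eq_bigr => w; rewrite in_ball // => wN.
  by rewrite wN (big_pred1 (extend eta w)) // /H (ltn_eqF (leq_ltn_trans wN _)) // mulr1.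
rewrite /integrate_children.
rewrite (prod_ball_children _
  (fun v w => \sum_s interaction w (extend eta v) s * alpha w s)).
rewrite big_seq_cond [RHS]big_seq_cond; apply: eq_big => [w|w].
  by rewrite in_ball // -ltnNge eqn_leq andbA andbb.
rewrite in_ball // -ltnNge => /andP[w1 w2].
have wN : depth w = N.+1 by apply/eqP; rewrite eqn_leq w1.
apply: eq_big => [s|s _]; first by rewrite wN ltnn.
by rewrite /H wN eqxx -(depth_eq0 o tree) wN.
Qed.

Lemma boundary_sum0 kappa alpha :
  boundary_sum 0 kappa alpha = \sum_b kappa b * alpha o b.
Proof.
have oB : o \in ball 0 by rewrite in_ball // depth_o.
have valo (u : ball 0) : val u = o.
  by have := valP u; rewrite in_ball // leqn0 depth_eq0 // => /eqP.
rewrite /boundary_sum (reindex (fun b : bool => [ffun=> b] : config 0)) /=; last first.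
  exists (fun eta => extend eta o) => [b|eta] _.
    by rewrite extend_in ffunE.
  by apply/ffunP => u; rewrite ffunE -(extend_val eta u) valo.
apply: eq_bigr => b _.
have eo : extend ([ffun=> b] : config 0) o = b.
  by rewrite extend_in ffunE.
rewrite eo weightE big_seq_cond big_pred0 ?mul1r; last first.
  by move=> w; rewrite in_ball // leqn0 depth_eq0 // andbN.
rewrite big_seq_cond (eq_bigl (pred1 o)) => [|w]; last first.
  by rewrite in_ball // leqn0 depth_eq0 // andbb.
by rewrite -big_filter filter_pred1_uniq ?fset_uniq // big_seq1 eo.
Qed.

Lemma boundary_sumE N kappa alpha : boundary_sum N kappa alpha =
  \sum_b kappa b * iter N integrate_children alpha o b.
Proof.
elim: N alpha => [|N IH] alpha; first exact: boundary_sum0.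
by rewrite boundary_sum_rec IH iterSr.
Qed.

Let t w := tanh (beta * J w).
Hypothesis t_itv : forall v, v != o -> 0 < t v < 1.
Local Notation plus := (fun (_ : V) (b : bool) => b%:R : R).

(** The hypothesis makes [f s] proportional to [1 + s m], while [exp (beta J b s) = cosh (beta J) (1
    + b s t)]; summing over [s] leaves [1 + b t m]. *)
Lemma sum_interaction w b (f : bool -> R) m :
  f true - f false = m * (f true + f false) ->
  \sum_s interaction w b s * f s =
  (expR (beta * J w) + expR (- (beta * J w))) / 2 * (f true + f false) *
  (1 + spin b * (t w * m)).
Proof.
move=> e; rewrite big_bool /= /interaction /t /tanh.
have : f true = (1 + m) * (f true + f false) / 2 by lra.
have : f false = (1 - m) * (f true + f false) / 2 by lra.
move: (f true + f false) => S -> ->.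
have := expR_gt0 (beta * J w); have := expR_gt0 (- (beta * J w)).
case: b; rewrite /= ?(mulr1, mulrN1, opprK).
all: move: (expR (beta * J w)) (expR (- (beta * J w))) => x y y0 x0.
all: by field; lra.
Qed.

(** The factors [C w] do not depend on the spin of [v], so they cancel from the normalized
    difference and leave the [rsum]. *)
Lemma iter_integrate_children k v :
  let f := iter k integrate_children plus v in
  0 < f true + f false /\
  f true - f false = magnetization adj o t k v * (f true + f false).
Proof.
elim: k v => [|k IH] v /=; first by rewrite addr0 subr0 mul1r ltr01.
set g := iter k _ _ in IH *.
pose x w := t w * magnetization adj o t k w.
pose C w := (expR (beta * J w) + expR (- (beta * J w))) / 2 * (g w true + g w false).
have fE b : integrate_children g v b =
    \prod_(w <- fset_set (children adj o v)) C w *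
    \prod_(w <- fset_set (children adj o v)) (1 + spin b * x w).
  rewrite -big_split /=; apply: eq_bigr => w _.
  by have [_ /(sum_interaction w b) ->] := IH w.
rewrite !{}fE /=.
have C0 : 0 < \prod_(w <- fset_set (children adj o v)) C w.
  apply: prodr_gt0 => w _; have [g0 _] := IH w.
  apply: mulr_gt0 => //; apply: divr_gt0 => //.
  by apply: addr_gt0; exact: expR_gt0.
have -> : \prod_(w <- fset_set (children adj o v)) (1 + 1 * x w) =
          \prod_(w <- fset_set (children adj o v)) (1 + x w).
  by apply: eq_bigr => w _; rewrite mul1r.
have -> : \prod_(w <- fset_set (children adj o v)) (1 + -1 * x w) =
          \prod_(w <- fset_set (children adj o v)) (1 - x w).
  by apply: eq_bigr => w _; rewrite mulN1r.
have hx w : w \in fset_set (children adj o v) -> 0 <= x w <= 1.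
  by move=> vw; apply: (scale_itv tree loc_fin t_itv vw); exact: magnetization_itv.
have [_ _ S0 _ _] := prod_oneDB_bounds hx; rewrite -mulrDr -mulrBr.
split; first by apply: mulr_gt0 => //; lra.
by rewrite mulrCA /rsum divfK //; lra.
Qed.

Lemma prob_root_plus N : prob_plus adj o J beta N (root_plus adj o N) =
  (1 + magnetization adj o t N o) / 2.
Proof.
have oB : o \in ball N by rewrite in_ball // depth_o.
have rootE (eta : config N) : root_plus adj o N eta = extend eta o.
  rewrite extend_in.
  apply/existsP/idP => [[u /andP[/eqP uo]]|h]; last by exists [` oB]%fset; rewrite eqxx.
  by rewrite (_ : u = [` oB]%fset) //; exact: val_inj.
(* The indicator of the boundary condition is itself a product of external factors at depth [N]. *)
have pbE (eta : config N) : (plus_boundary eta)%:R =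
    \prod_(w <- ball N | depth w == N) plus w (extend eta w).
  rewrite big_seq_fsetE /=; under eq_bigr do rewrite extend_val.
  have [h|] := boolP (plus_boundary eta).
    by rewrite big1 // => w wN; move/forallP: h => /(_ w) /implyP /(_ wN) ->.
  rewrite negb_forall => /existsP[w]; rewrite negb_imply => /andP[wN /negbTE ew].
  by rewrite (bigD1 w) //= ew mul0r.
have sumE (A : pred (config N)) kappa : (forall eta, (A eta)%:R = kappa (extend eta o)) ->
    \sum_(eta : config N | plus_boundary eta && A eta) weight J beta eta =
    boundary_sum N kappa plus.
  move=> AE; rewrite big_mkcond; apply: eq_bigr => eta _.
  by rewrite -AE -pbE; case: plus_boundary; case: (A eta); rewrite /= ?(mulr1, mulr0, mul1r, mul0r).
have Zf : partition_function adj o J beta N = boundary_sum N (fun=> 1) plus.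
  rewrite -(sumE xpredT) // /partition_function.
  by apply: eq_bigl => eta; rewrite andbT.
rewrite /prob_plus -big_distrl /= (sumE _ (fun b => b%:R)); last by move=> eta; rewrite rootE.
rewrite Zf !boundary_sumE !big_bool /= !mul1r mul0r addr0.
have := iter_integrate_children N o; set g := iter _ _ _ _ => /=.
move: (g true) (g false) => a b [ab0 e].
by apply: (@mulIf _ (a + b)); rewrite ?divfK ?lt0r_neq0 //; lra.
Qed.

End IsingRecursion.

(** * Rays through a given vertex *)

Section Rays.
Context {V : choiceType} {adj : rel V} (o : V).
Hypothesis tree : is_tree adj.
Hypothesis no_leaf : forall v, v != o -> ~ is_leaf adj v.
Local Notation root_path := (root_path adj o).
Local Notation depth := (depth adj o).
Local Notation parent := (parent adj o).
Local Notation parent_of := (parent_of (adj := adj) o).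

Lemma root_path_neq_root v w : w \in root_path v -> w != o.
Proof.
move=> wv; have [_ _ /= /andP[ov _]] := root_pathP o tree v.
by apply: contraNneq ov => wo; rewrite -{1}wo.
Qed.

Lemma sum_root_path_ray (R : pzRingType) (F : V -> R) y n : boundary adj o y ->
  \sum_(w <- root_path (y n)) F w = \sum_(0 <= i < n) F (y i.+1).
Proof.
move=> [y0 yS]; elim: n => [|n IH].
  by rewrite y0 root_path_o // big_nil big_geq.
by rewrite (parent_root_path tree (yS n)) big_rcons big_nat_recr //= IH.
Qed.

Lemma depth_iter_parent_of j v : (j <= depth v)%N ->
  depth (iter j parent_of v) = (depth v - j)%N.
Proof.
elim: j => [|j IH] jv; first by rewrite subn0.
have e := IH (ltnW jv).
have wo : iter j parent_of v != o.
  by rewrite -(depth_eq0 o tree) e subn_eq0 -ltnNge.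
have := depth_parent tree (parent_parent_of tree wo).
by rewrite iterS e subnS => ->.
Qed.

Lemma exists_ray v : v != o -> exists2 y, boundary adj o y & y (depth v) = v.
Proof.
move=> vo.
have [ch chP] : exists ch : V -> V, forall w, w != o -> parent w (ch w).
  have h w : exists u, w != o -> parent w u.
    have [_|wo] := eqVneq w o; first by exists o.
    by have [u wu] := exists_child tree wo (no_leaf wo); exists u.
  by have [ch chP] := choice h; exists ch.
(* Truncated subtraction makes one iteration trivial: ancestors of [v] up to its depth, chosen
   children afterwards. *)
pose y n := iter (n - depth v) ch (iter (depth v - n) parent_of v).
exists y; last by rewrite /y subnn.
split.
  apply/eqP; rewrite -(depth_eq0 o tree) /y sub0n subn0 /=.
  by rewrite depth_iter_parent_of ?subnn.
move=> n; rewrite /y; case: (ltnP n (depth v)) => nv.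
  rewrite (eqP (ltnW nv : n - depth v == 0)%N) (eqP (nv : n.+1 - depth v == 0)%N) /=.
  rewrite -(subnSK nv) /=; apply: parent_parent_of => //.
  rewrite -(depth_eq0 o tree) depth_iter_parent_of ?leq_subr //.
  by rewrite subKn.
rewrite subSn // (eqP (nv : depth v - n == 0)%N) (eqP (leqW nv : depth v - n.+1 == 0)%N) /=.
apply: (chP); elim: (n - depth v)%N => [|k IH] //=.
exact: (parent_neq_root tree (chP _ IH)).
Qed.

End Rays.

(** * Resistances, flows and their potentials *)

Section Resistance.
Context {R : realType} {V : choiceType} {adj : rel V} (o : V) (t : V -> R).
Hypothesis tree : is_tree adj.
Hypothesis loc_fin : locally_finite adj.
Hypothesis no_leaf : forall v, v != o -> ~ is_leaf adj v.
Hypothesis t_itv : forall v, v != o -> 0 < t v < 1.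
Local Notation root_path := (root_path adj o).
Local Notation parent := (parent adj o).
Local Notation parent_of := (parent_of (adj := adj) o).
Local Notation kids v := (fset_set (children adj o v)).

(** Convertible to [ising_resistance] when [t w] is [tanh (beta * J w)]. *)
Definition resistance (v : V) : R := \prod_(y <- root_path v) (t y)^-1.

Lemma resistance_gt0 v : 0 < resistance v.
Proof.
rewrite /resistance big_seq; apply: prodr_gt0 => w /(root_path_neq_root tree).
by move=> /t_itv /andP[tw _]; rewrite invr_gt0.
Qed.

Lemma resistance_root : resistance o = 1.
Proof. by rewrite /resistance root_path_o // big_nil. Qed.

Lemma resistance_child v w : parent v w -> resistance v = resistance w * t w.
Proof.
move=> vw; have /andP[tw _] := t_itv (parent_neq_root tree vw).
rewrite /resistance (parent_root_path tree vw) big_rcons /=.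
by rewrite divfK // lt0r_neq0.
Qed.

Lemma sum_children (F : V -> R) v :
  \sum_(w \in children adj o v) F w = \sum_(w <- kids v) F w.
Proof. by rewrite fsbig_finite //; exact: finite_children. Qed.

Lemma path_potentialE mu y : is_flow adj o mu -> boundary adj o y ->
  path_potential 3 resistance mu y =
  (\sum_(0 <= n <oo) ((mu (y n.+1) * resistance (y n.+1)) ^+ 2)%:E)%E.
Proof.
move=> [mu0 _] [_ yS]; apply: eq_eseriesr => n _; congr EFin.
rewrite (_ : 3 - 1 = 2%:R); last by lra.
rewrite powR_mulrn // mulr_ge0 //; last exact/ltW/resistance_gt0.
exact/mu0/(parent_neq_root tree (yS n)).
Qed.

(** Some ray passes through [v], and the sum up to [v] is a partial sum of its nonnegative
    series. *)
Lemma flow_energy_le_potential mu v : is_flow adj o mu -> v != o ->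
  ((\sum_(w <- root_path v) (mu w * resistance w) ^+ 2)%:E <=
   potential adj o 3 resistance mu)%E.
Proof.
move=> fmu vo; have [y yb yv] := exists_ray tree no_leaf vo.
apply: (@le_trans _ _ (path_potential 3 resistance mu y)); last first.
  by apply: ereal_sup_ubound; exists y.
rewrite path_potentialE // -{1}yv.
rewrite (sum_root_path_ray tree (fun w => (mu w * resistance w) ^+ 2)) // -sumEFin.
by apply: nneseries_lim_ge => n _ _; rewrite lee_fin sqr_ge0.
Qed.

Lemma potential_scale mu r : is_flow adj o mu -> 0 < r ->
  potential adj o 3 resistance (fun v => r * mu v) =
  ((r ^+ 2)%:E * potential adj o 3 resistance mu)%E.
Proof.
move=> fmu r0; rewrite /potential -ereal_sup_pZl ?exprn_gt0 //; congr ereal_sup.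
have frmu : is_flow adj o (fun v => r * mu v).
  have [mu0 muS] := fmu; split => [w wo|v w vw wl].
    by apply: mulr_ge0; [exact: ltW|exact: mu0].
  by rewrite (muS _ _ vw wl) mulr_fsumr.
have E y : boundary adj o y -> path_potential 3 resistance (fun v => r * mu v) y =
    ((r ^+ 2)%:E * path_potential 3 resistance mu y)%E.
  move=> yb; rewrite !path_potentialE // -nneseriesZl => [|n _]; last first.
    by rewrite lee_fin sqr_ge0.
  by apply: eq_eseriesr => n _; rewrite -mulrA exprMn EFinM.
apply/seteqP; split => z /= [].
  by move=> y yb <-; exists (path_potential 3 resistance mu y); [exists y|rewrite E].
by move=> _ [y yb <-] <-; exists y => //; rewrite E.
Qed.

Lemma flow_strength_scale (mu : V -> R) r :
  flow_strength adj o (fun v => r * mu v) = r * flow_strength adj o mu.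
Proof. by rewrite /flow_strength mulr_fsumr. Qed.

Lemma is_flow_scale (mu : V -> R) r : 0 <= r -> is_flow adj o mu ->
  is_flow adj o (fun v => r * mu v).
Proof.
move=> r0 [mu0 muS]; split => [w wo|v w vw wl].
  by apply: mulr_ge0 => //; exact: mu0.
by rewrite (muS _ _ vw wl) mulr_fsumr.
Qed.

Lemma flow_strength_ge0 (mu : V -> R) : is_flow adj o mu -> 0 <= flow_strength adj o mu.
Proof.
move=> [mu0 _]; rewrite /flow_strength sum_children big_seq.
apply: sumr_ge0 => w; rewrite in_children // => /(parent_neq_root tree).
exact: mu0.
Qed.

(** A nonpositive potential would force zero flow through every edge at the root. *)
Lemma potential_gt0 mu : is_flow adj o mu -> 0 < flow_strength adj o mu ->
  (0 < potential adj o 3 resistance mu)%E.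
Proof.
move=> fmu s0; rewrite ltNge; apply/negP => p0; move: s0; apply/negP.
rewrite -leNgt /flow_strength sum_children big_seq; apply: sumr_le0 => w.
rewrite in_children // => ow; have wo := parent_neq_root tree ow.
have := le_trans (flow_energy_le_potential fmu wo) p0; rewrite lee_fin.
rewrite (parent_root_path tree ow) root_path_o //= big_seq1 => h.
rewrite -(pmulr_lle0 _ (resistance_gt0 w)) le_eqVlt; apply/orP; left.
by rewrite -sqrf_eq0 eq_le h sqr_ge0.
Qed.

(** * A flow bounds the magnetization from below *)

Section LowerBound.
Variable mu : V -> R.
Hypothesis flow : is_flow adj o mu.
Hypothesis pot : (potential adj o 3 resistance mu <= 1)%E.

(** The root gets a fictitious incoming edge of resistance 1 carrying the whole strength, so that
    [drop_children] holds there too. *)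
Let drop v := (if v == o then flow_strength adj o mu else mu v) * resistance v.
Let energy v := \sum_(w <- root_path v) drop w ^+ 2.

Lemma energy_le1 v : energy v <= 1.
Proof.
have [->|vo] := eqVneq v o; first by rewrite /energy root_path_o // big_nil.
rewrite -lee_fin; apply: le_trans pot.
rewrite (_ : energy v = \sum_(w <- root_path v) (mu w * resistance w) ^+ 2).
  exact: flow_energy_le_potential.
rewrite /energy big_seq [RHS]big_seq; apply: eq_bigr => w.
by move=> /(root_path_neq_root tree) /negbTE wo; rewrite /drop wo.
Qed.

Lemma drop_children v : drop v = \sum_(w <- kids v) t w * drop w.
Proof.
have -> : drop v = resistance v * \sum_(w <- kids v) mu w.
  rewrite /drop mulrC -sum_children; case: eqVneq => [->//|vo].
  have [_ muS] := flow.
  by rewrite (muS _ _ (parent_parent_of tree vo) (no_leaf vo)).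
rewrite big_distrr /= big_seq [RHS]big_seq; apply: eq_bigr => w.
rewrite in_children // => vw; rewrite (resistance_child vw) /drop.
by rewrite (negbTE (parent_neq_root tree vw)); ring.
Qed.

Lemma drop_ge0 v : 0 <= drop v.
Proof.
apply: mulr_ge0; last exact/ltW/resistance_gt0.
by case: eqVneq => [_|vo]; [exact: flow_strength_ge0|exact: (proj1 flow)].
Qed.

(** At a child of [v] the bracket is [1 - energy v], the same for all children, so its square root
    comes out of the sum over them. *)
Lemma drop_le_magnetization k v :
  drop v ^+ 2 <= (1 - energy v + drop v ^+ 2) * magnetization adj o t k v ^+ 2.
Proof.
elim: k v => [|k IH] v; first by rewrite expr1n mulr1; have := energy_le1 v; lra.
set K := 1 - energy v.
have K0 : 0 <= K by rewrite /K; have := energy_le1 v; lra.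
pose x w := t w * magnetization adj o t k w.
have hx w : w \in kids v -> 0 <= x w <= 1.
  by move=> vw; apply: (scale_itv tree loc_fin t_itv vw); exact: magnetization_itv.
have aX : drop v <= Num.sqrt K * \sum_(w <- kids v) x w.
  rewrite drop_children big_distrr /= big_seq [leRHS]big_seq.
  apply: ler_sum => w; rewrite in_children // => vw.
  have /andP[tw _] := t_itv (parent_neq_root tree vw).
  rewrite /x [leRHS]mulrCA ler_pM2l //.
  have /andP[m0 _] := magnetization_itv tree loc_fin t_itv k w.
  rewrite -ler_sqr ?nnegrE ?drop_ge0 //; last first.
    by apply: mulr_ge0 => //; exact: sqrtr_ge0.
  rewrite [leRHS]exprMn sqr_sqrtr //; have := IH w.
  rewrite /energy (parent_root_path tree vw) big_rcons /= -/(energy v).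
  by rewrite (_ : 1 - _ + _ = K) // /K; ring.
have a2X : drop v ^+ 2 <= K * (\sum_(w <- kids v) x w) ^+ 2.
  rewrite -(sqr_sqrtr K0) -[leRHS]exprMn ler_sqr ?nnegrE ?drop_ge0 //.
  by apply: le_trans aX; exact: drop_ge0.
have /= := sqr_sum_le_rsum hx; have := rsum_itv hx; rewrite -/x.
move: a2X; move: (\sum_(w <- _) _) (rsum _ _) (drop v) => X M a a2X hM XM.
have M1 : M ^+ 2 <= 1 by have : M ^+ 2 <= 1 ^+ 2 by [rewrite ler_sqr ?nnegrE; lra]; lra.
(* The [rsum] bound reads [X ^+ 2 * (1 - M ^+ 2) <= M ^+ 2], whence
   [a ^+ 2 * (1 - M ^+ 2) <= K * M ^+ 2]. *)
have : a ^+ 2 * (1 - M ^+ 2) <= K * X ^+ 2 * (1 - M ^+ 2).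
  by apply: ler_wpM2r => //; lra.
have : 0 <= K * (M ^+ 2 - X ^+ 2 * (1 - M ^+ 2)) by apply: mulr_ge0; lra.
lra.
Qed.

Lemma flow_strength_le_magnetization k :
  flow_strength adj o mu ^+ 2 <=
  (1 + flow_strength adj o mu ^+ 2) * magnetization adj o t k o ^+ 2.
Proof.
have := drop_le_magnetization k o.
by rewrite /energy /drop root_path_o // big_nil eqxx resistance_root mulr1 subr0.
Qed.

End LowerBound.

(** * A positive solution of the recursion yields a flow of finite potential *)

Section UpperBound.
Variables (m : V -> R) (c : R).
Hypothesis m_itv : forall v, 0 <= m v <= 1.
Hypothesis m_rec : forall v, m v = rsum (kids v) (fun w => t w * m w).
Hypothesis m_root : 0 < m o.
Hypothesis c_gt0 : 0 < c.
Hypothesis t_far : forall v, v != o -> 2 * c <= 1 - t v ^+ 2.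

Let share w := half (t w * m w).
Let total v := \sum_(w <- kids v) share w.

(** The proportional splitting unrolled along the root path; where [total] vanishes the quotient is
    0 by convention. *)
Definition recursion_flow (v : V) : R :=
  half (m o) * \prod_(w <- root_path v) (share w / total (parent_of w)).
Local Notation mu := recursion_flow.

Lemma share_ge0 v w : parent v w -> 0 <= share w.
Proof.
rewrite -(in_children o loc_fin) => vw.
by have /half_itv/andP[] := scale_itv tree loc_fin t_itv vw (m_itv w).
Qed.

Lemma total_ge0 v : 0 <= total v.
Proof.
rewrite /total big_seq; apply: sumr_ge0 => w; rewrite in_children //.
exact: share_ge0.
Qed.

Lemma half_le_total v : half (m v) <= total v.
Proof.
rewrite m_rec; apply: half_rsum_le => w vw.
exact: (scale_itv tree loc_fin t_itv vw).
Qed.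

Lemma recursion_flow_child v w : parent v w -> mu w = mu v * (share w / total v).
Proof.
move=> vw; rewrite /mu (parent_root_path tree vw) big_rcons /=.
by rewrite (parent_ofP tree vw) mulrA.
Qed.

Lemma recursion_flow_ge0 v : 0 <= mu v.
Proof.
apply: mulr_ge0; first exact/ltW/half_gt0.
rewrite big_seq; apply: prodr_ge0 => w /(root_path_neq_root tree) wo.
apply: divr_ge0; last exact: total_ge0.
exact: share_ge0 (parent_parent_of tree wo).
Qed.

(** If [m v = 0] then [share v = 0] and nothing flows into [v]; hence the denominators are positive
    wherever there is flow. *)
Lemma recursion_flow_neq0 v : mu v != 0 -> 0 < half (m v).
Proof.
have [->|vo] := eqVneq v o; first by move=> _; exact: half_gt0.
rewrite (recursion_flow_child (parent_parent_of tree vo)) => h.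
apply: half_gt0; rewrite lt_neqAle; have /andP[-> _] := m_itv v; rewrite andbT.
by apply: contraNneq h => mv0; rewrite /share -mv0 /half !(mulr0, mul0r).
Qed.

Lemma recursion_flow_sum v : mu v = \sum_(w <- kids v) mu w.
Proof.
rewrite (eq_big_seq (fun w => mu v / total v * share w)); last first.
  by move=> w; rewrite in_children // => /recursion_flow_child ->; ring.
rewrite -big_distrr /= -/(total v); have [->|h] := eqVneq (mu v) 0.
  by rewrite !mul0r.
rewrite divfK // lt0r_neq0 //.
exact: lt_le_trans (recursion_flow_neq0 h) (half_le_total v).
Qed.

Lemma recursion_flow_is_flow : is_flow adj o mu.
Proof.
split=> [w _|v w _ _]; first exact: recursion_flow_ge0.
by rewrite sum_children -recursion_flow_sum.
Qed.

Lemma recursion_flow_strength : flow_strength adj o mu = half (m o).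
Proof.
rewrite /flow_strength sum_children -recursion_flow_sum.
by rewrite /mu root_path_o // big_nil mulr1.
Qed.

(** The telescoping quantity [b_v], equal to 1 at the root. *)
Let ratio v := mu v * resistance v / half (m v).

Lemma ratio_decrease v w : parent v w ->
  ratio w ^+ 2 + c * (mu w * resistance w) ^+ 2 <= ratio v ^+ 2.
Proof.
move=> vw; have wo := parent_neq_root tree vw.
have [w0|w0] := eqVneq (mu w) 0.
  by rewrite /ratio w0 !mul0r expr0n /= mulr0 addr0 sqr_ge0.
have mv0 : mu v != 0.
  by apply: contraNneq w0 => v0; rewrite (recursion_flow_child vw) v0 mul0r.
have Gw := recursion_flow_neq0 w0; have Gv := recursion_flow_neq0 mv0.
have Gt := half_le_total v; have tt := t_itv wo; have s0 := share_ge0 vw.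
have Rw := resistance_gt0 w; have muv := recursion_flow_ge0 v.
have Rv := resistance_gt0 v.
have r0 : 0 <= ratio v by apply: divr_ge0; [apply: mulr_ge0|]; try exact: ltW.
have aE : t w * (mu w * resistance w) = ratio v * (half (m v) / total v) * share w.
  rewrite /ratio (recursion_flow_child vw) (resistance_child vw).
  by field; apply/andP; split; lra.
(* Subadditivity enters here, as [half (m v) <= total v]. *)
have ta : t w * (mu w * resistance w) <= ratio v * share w.
  rewrite aE -mulrA; apply: ler_wpM2l => //.
  by rewrite ler_piMl // ler_pdivrMr ?mul1r //; lra.
have a0 : 0 <= mu w * resistance w by rewrite mulr_ge0 ?recursion_flow_ge0 // ltW.
have := sqr_half_scale_le (m_itv w) tt (ltW c_gt0) (t_far wo).
rewrite -/(share w).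
rewrite {1}/ratio; move: Gw a0 ta tt r0 s0.
move: (half (m w)) (mu w * resistance w) (ratio v) (share w) (t w) => G a r s u.
move=> G0 a0 ta /andP[u0 _] r0 s0 hs.
have -> : (a / G) ^+ 2 + c * a ^+ 2 = a ^+ 2 * (1 + c * G ^+ 2) / G ^+ 2.
  by field; lra.
rewrite ler_pdivrMr ?exprn_gt0 // -(ler_pM2l (exprn_gt0 2 u0)).
rewrite mulrA -exprMn.
apply: (@le_trans _ _ ((r * s) ^+ 2 * (1 + c * G ^+ 2))).
  apply: ler_wpM2r.
    by have : 0 <= c * G ^+ 2 by [apply: mulr_ge0; [exact: ltW|exact: sqr_ge0]]; lra.
  by rewrite ler_sqr ?nnegrE ?mulr_ge0 // ltW.
rewrite exprMn -mulrA (mulrCA (u ^+ 2)).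
by apply: ler_wpM2l => //; exact: sqr_ge0.
Qed.

Lemma recursion_flow_potential :
  (potential adj o 3 resistance mu <= (c^-1)%:E)%E.
Proof.
apply: ge_ereal_sup => _ [y yb <-].
rewrite (path_potentialE recursion_flow_is_flow yb).
apply: lime_le; first by apply: is_cvg_nneseries => n _ _; rewrite lee_fin sqr_ge0.
apply: nearW => n; rewrite sumEFin lee_fin -(ler_pM2l c_gt0) mulfV ?lt0r_neq0 //.
have [y0 yS] := yb.
(* The telescoped form of [ratio_decrease] along the ray. *)
suff : ratio (y n) ^+ 2 +
    c * \sum_(0 <= i < n) (mu (y i.+1) * resistance (y i.+1)) ^+ 2 <= 1.
  by have := sqr_ge0 (ratio (y n)); lra.
elim: n => [|n IH].
  rewrite big_geq // mulr0 addr0 y0 /ratio resistance_root mulr1.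
  rewrite /mu root_path_o // big_nil mulr1 divff ?expr1n //.
  by rewrite lt0r_neq0 // half_gt0.
rewrite big_nat_recr //= mulrDr; have := ratio_decrease (yS n); lra.
Qed.

End UpperBound.

(** * Positivity and vanishing of the capacity *)

Lemma capacity_gt0 mu : is_flow adj o mu -> 0 < flow_strength adj o mu ->
  (potential adj o 3 resistance mu < +oo)%E ->
  (0 < capacity adj o 3 resistance)%E.
Proof.
move=> fmu s0 pfin; have p0 := potential_gt0 fmu s0.
have pE : potential adj o 3 resistance mu \is a fin_num.
  by rewrite ge0_fin_numE // ltW.
have p0' : 0 < fine (potential adj o 3 resistance mu) by rewrite fine_gt0 // p0.
(* The potential is homogeneous of degree 2, so this factor brings it to exactly 1. *)
pose r := (Num.sqrt (fine (potential adj o 3 resistance mu)))^-1.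
have r0 : 0 < r by rewrite invr_gt0 sqrtr_gt0.
have mem : [set (flow_strength adj o nu)%:E | nu in
    [set nu | is_flow adj o nu /\ potential adj o 3 resistance nu = 1%E]]
    (r * flow_strength adj o mu)%:E.
  exists (fun v => r * mu v); last by rewrite flow_strength_scale.
  split; first by apply: is_flow_scale fmu; exact: ltW.
  rewrite potential_scale // -(fineK pE) -EFinM /r exprVn sqr_sqrtr ?mulVf //.
    exact: lt0r_neq0.
  exact: ltW.
rewrite /capacity; case: ifPn => [/eqP h|_].
  by rewrite h in mem.
apply: (@lt_le_trans _ _ (r * flow_strength adj o mu)%:E).
  by rewrite lte_fin mulr_gt0.
exact: ereal_sup_ubound mem.
Qed.

Lemma capacity_eq0 :
  (forall mu, is_flow adj o mu -> potential adj o 3 resistance mu = 1%E ->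
    flow_strength adj o mu = 0) ->
  capacity adj o 3 resistance = 0%E.
Proof.
move=> h; rewrite /capacity; case: ifPn => // /set0P [_ [mu [fmu pmu] _]].
rewrite (_ : [set _ | _ in _] = [set 0%E]) ?ereal_sup1 //.
apply/seteqP; split => z /=; first by move=> [nu [fnu pnu] <-]; rewrite h.
by move=> ->; exists mu => //; rewrite h.
Qed.

(** * The limiting magnetization and the capacity criterion *)

Lemma cvg_rsum s (x : nat -> V -> R) (y : V -> R) :
  (forall w, x n w @[n --> \oo] --> y w) ->
  (forall w, w \in s -> 0 <= y w <= 1) ->
  rsum s (x n) @[n --> \oo] --> rsum s y.
Proof.
move=> xy hy; have [_ _ S2 _ _] := prod_oneDB_bounds hy.
have hP : \prod_(w <- s) (1 + x n w) @[n --> \oo] --> \prod_(w <- s) (1 + y w).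
  apply: cvg_big => [|w _]; first exact: mul_continuous.
  by apply: cvgD; [exact: cvg_cst|exact: xy].
have hQ : \prod_(w <- s) (1 - x n w) @[n --> \oo] --> \prod_(w <- s) (1 - y w).
  apply: cvg_big => [|w _]; first exact: mul_continuous.
  by apply: cvgB; [exact: cvg_cst|exact: xy].
apply: cvgM; first exact: cvgB.
(* The limiting denominator is at least 2. *)
by apply: cvgV; [rewrite lt0r_neq0 //; lra|exact: cvgD].
Qed.

Local Notation mag k v := (magnetization adj o t k v).

Lemma magnetization_homo v : nonincreasing_seq (fun k => mag k v).
Proof. by apply/nonincreasing_seqP => k; exact: magnetization_nonincreasing. Qed.

Lemma cvg_magnetization v : cvgn (fun k => mag k v).
Proof.
apply: nonincreasing_is_cvgn; first exact: magnetization_homo.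
exists 0 => _ [k _ <-]; have /andP[] := magnetization_itv tree loc_fin t_itv k v.
by [].
Qed.

Lemma limn_magnetization_itv v : 0 <= limn (fun k => mag k v) <= 1.
Proof.
apply/andP; split.
  apply: limr_ge; first exact: cvg_magnetization.
  by apply: nearW => k; have /andP[] := magnetization_itv tree loc_fin t_itv k v.
by have := nonincreasing_cvgn_ge (@magnetization_homo v) (@cvg_magnetization v) 0.
Qed.

Lemma limn_magnetization_rec v : limn (fun k => mag k v) =
  rsum (kids v) (fun w => t w * limn (fun k => mag k w)).
Proof.
(* Shifting the index by one level exposes the recursion under the limit. *)
apply: cvg_lim => //; rewrite -(cvg_shiftn 1).
under eq_fun do rewrite addn1 /=.
apply: cvg_rsum => [w|w vw].
  by apply: cvgM; [exact: cvg_cst|exact: cvg_magnetization].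
exact: (scale_itv tree loc_fin t_itv vw (limn_magnetization_itv w)).
Qed.

Lemma limn_magnetization_eq0 c : 0 < c ->
  (forall v, v != o -> 2 * c <= 1 - t v ^+ 2) ->
  limn (fun k => mag k o) = 0 <-> capacity adj o 3 resistance = 0%E.
Proof.
move=> c0 tc; split => [m0|cap0].
  apply: capacity_eq0 => mu fmu pmu.
  (* The finite-level bound is uniform in [k]; a zero limit then forces zero strength. *)
  have h : flow_strength adj o mu ^+ 2 <=
      (1 + flow_strength adj o mu ^+ 2) * limn (fun k => mag k o) ^+ 2.
    have hc : (1 + flow_strength adj o mu ^+ 2) * mag k o ^+ 2 @[k --> \oo] -->
        (1 + flow_strength adj o mu ^+ 2) * limn (fun k => mag k o) ^+ 2.
      apply: cvgM; first exact: cvg_cst.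
      by apply: cvgM; exact: cvg_magnetization.
    rewrite -(cvg_lim _ hc) //; apply: limr_ge; first by apply/cvg_ex; eexists; exact: hc.
    apply: nearW => k; apply: flow_strength_le_magnetization => //.
    by rewrite pmu.
  move: h; rewrite m0 expr0n /= mulr0 => h; apply/eqP.
  by rewrite -sqrf_eq0 eq_le h sqr_ge0.
apply/eqP; rewrite eq_le; have /andP[-> _] := limn_magnetization_itv o; rewrite andbT.
rewrite leNgt; apply/negP => m0.
have pot := recursion_flow_potential limn_magnetization_itv limn_magnetization_rec m0 c0 tc.
have fl := recursion_flow_is_flow limn_magnetization_itv limn_magnetization_rec m0.
have str := recursion_flow_strength limn_magnetization_itv limn_magnetization_rec m0.
suff : (0 < capacity adj o 3 resistance)%E by rewrite cap0 ltxx.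
apply: (capacity_gt0 fl); first by rewrite str half_gt0.
by apply: le_lt_trans pot _; rewrite ltry.
Qed.

End Resistance.

(** * Bounds on tanh *)

Section Tanh.
Context {R : realType}.
Implicit Types x y : R.

Lemma tanh_itv x : 0 < x -> 0 < tanh x < 1.
Proof.
move=> x0; rewrite /tanh.
have := expR_gt0 (- x); have : expR (- x) < expR x by rewrite ltr_expR; lra.
move: (expR x) (expR (- x)) => p q qp q0.
by rewrite divr_gt0 ?ltr_pdivrMr; lra.
Qed.

(** The right side is [4 / (p + q) ^+ 2] with [p = expR x] and [q = expR (- x) < p], hence at least
    [q ^+ 2]. It keeps [t] uniformly away from 1 when the interactions are bounded. *)
Lemma one_sub_sqr_tanh_ge x y : 0 < x <= y -> expR (- y) ^+ 2 <= 1 - tanh x ^+ 2.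
Proof.
move=> /andP[x0 xy]; rewrite /tanh.
have e : expR x * expR (- x) = 1 by rewrite -expRD subrr expR0.
have := expR_gt0 (- x); have : expR (- x) < expR x by rewrite ltr_expR; lra.
have : expR (- y) <= expR (- x) by rewrite ler_expR; lra.
have := expR_gt0 (- y).
move: e; move: (expR x) (expR (- x)) (expR (- y)) => p q z e z0 zq qp q0.
have -> : 1 - ((p - q) / (p + q)) ^+ 2 = 4 * (p * q) / (p + q) ^+ 2 by field; lra.
rewrite e ler_pdivlMr; last by apply: exprn_gt0; lra.
apply: (@le_trans _ _ (q ^+ 2 * (2 * p) ^+ 2)); last first.
  by rewrite -exprMn mulrCA (mulrC q) e; lra.
by apply: ler_pM; rewrite ?sqr_ge0 ?ler_sqr ?nnegrE; lra.
Qed.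

End Tanh.

(** * From the root probability to the capacity criterion *)

Theorem theorem2p2 (R : realType) (V : choiceType) (adj : rel V) (o : V)
    (J : V -> R) (Jmin Jmax beta : R)
    (tree : is_tree adj) (loc_fin : locally_finite adj)
    (tree_inf : infinite_set [set: V])
    (no_leaf : forall v, v != o -> ~ is_leaf adj v)
    (Jmin_gt0 : 0 < Jmin)
    (J_bounds : forall v, v != o -> Jmin <= J v <= Jmax)
    (beta_gt0 : 0 < beta) :
  let u : R^nat := fun N => prob_plus adj o J beta N (root_plus adj o N) in
  [/\ nonincreasing_seq u, cvgn u &
      limn u = 2^-1 <->
      capacity adj o 3 (ising_resistance adj o J beta) = 0%E].
Proof.
move=> u; pose t w := tanh (beta * J w).
have bJ v : v != o -> 0 < beta * J v <= beta * Jmax.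
  move=> /J_bounds /andP[J1 J2]; rewrite ler_pM2l // J2 andbT.
  by apply: mulr_gt0 => //; exact: lt_le_trans J1.
have t_itv v : v != o -> 0 < t v < 1 by move=> /bJ /andP[b0 _]; exact: tanh_itv.
have uE : u = fun N => (1 + magnetization adj o t N o) / 2.
  by apply/funext => N; exact: prob_root_plus.
have ucvg : u N @[N --> \oo] -->
    (1 + limn (fun N => magnetization adj o t N o)) / 2.
  rewrite uE; apply: cvgM; last exact: cvg_cst.
  by apply: cvgD; [exact: cvg_cst|exact: cvg_magnetization].
split.
- rewrite uE => m n mn; rewrite ler_pM2r ?invr_gt0 // lerD2l.
  exact: magnetization_homo.
- by apply/cvg_ex; eexists; exact: ucvg.
- rewrite (cvg_lim _ ucvg) //.
  have <- : limn (fun N => magnetization adj o t N o) = 0 <->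
      capacity adj o 3 (ising_resistance adj o J beta) = 0%E.
    (* This [c] is half the uniform lower bound on [1 - t v ^+ 2] coming from [J v <= Jmax]. *)
    apply: (limn_magnetization_eq0 tree loc_fin no_leaf t_itv
              (c := expR (- (beta * Jmax)) ^+ 2 / 2)).
      by rewrite divr_gt0 // exprn_gt0 // expR_gt0.
    by move=> v /bJ /one_sub_sqr_tanh_ge; rewrite [2 * _]mulrC divfK.
  by split=> h; lra.
Qed.
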